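(* Let $n\ge 34$ be an integer. Then the forcing spectrum of the generalized Petersen graph $P(n,2)$ is $$\left[\left\lceil \tfrac{n}{12}\right\rceil+1,\ \left\lceil \tfrac{n+3}{7}\right\rceil+\delta(n)\right]\cup\left[\left\lceil \tfrac{n+2}{6}\right\rceil,\ \left\lceil \tfrac{n}{4}\right\rceil\right],$$ where $\delta(n)=1$ if $n\equiv 3\pmod 7$ and $\delta(n)=0$ otherwise, and $[a,b]$ denotes the set of all integers $t$ with $a\le t\le b$.
   Context: For $n\ge 3$, $P(n,2)$ is the simple graph with vertex set $\{u_i,v_i:0\le i\le n-1\}$ and edge set $\{u_iu_{i+2},\,u_iv_i,\,v_iv_{i+1}:0\le i\le n-1\}$, subscripts modulo $n$. For a perfect matching $M$ of a graph $G$, a forcing set of $M$ is a subset $S\subseteq M$ that is contained in no perfect matching of $G$ other than $M$. The forcing number $f(G,M)$ is the minimum cardinality of a forcing set of $M$. The forcing spectrum of $G$ is the set $\{f(G,M): M \text{ a perfect matching of } G\}$. *)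

(* Defs.v *)
From mathcomp Require Import all_boot.

Set Implicit Arguments.
Unset Strict Implicit.
Unset Printing Implicit Defensive.

(* A finite simple graph on the vertex type V is given by its edge set
   E : {set {set V}}, the edge xy being the two-element set [set x; y]. *)
Section Forcing.
Variables (V : finType) (E : {set {set V}}).
Implicit Types (M S : {set {set V}}).

Definition perfect_matching M : bool :=
  (M \subset E) && [forall x : V, #|[set e in M | x \in e]| == 1].

Definition forcing_set M S : bool :=
  (S \subset M) &&
  [forall M' : {set {set V}}, perfect_matching M' && (S \subset M') ==> (M' == M)].

(* The default M of the arg min is itself a forcing set of M whenever M is a
   perfect matching of a simple graph: see forcing_set_self below. *)
Definition forcing_number M : nat :=
  #|[arg min_(S < M | forcing_set M S) #|S|]|.

Definition forcing_spectrum : pred nat :=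
  [pred t | [exists M, perfect_matching M && (forcing_number M == t)]].

Lemma forcing_set_self M :
  (forall e, e \in E -> e != set0) -> perfect_matching M -> forcing_set M M.
Proof.
move=> E0 /andP[_ /forallP pM]; rewrite /forcing_set subxx /=.
apply/forallP => M'; apply/implyP => /andP[/andP[sM'E /forallP pM'] sMM'].
rewrite eqEsubset sMM' andbT; apply/subsetP => e eM'.
have /set0Pn[x xe] := E0 e (subsetP sM'E e eM').
have /card_gt0P[d] : 0 < #|[set e in M | x \in e]| by rewrite (eqP (pM x)).
rewrite inE => /andP[dM xd].
have /cards1P[c cE] := pM' x.
have : e \in [set c] by rewrite -cE inE eM'.
have : d \in [set c] by rewrite -cE inE (subsetP sMM').
by rewrite !inE => /eqP <- /eqP ->.
Qed.

Lemma forcing_numberP M :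
  (forall e, e \in E -> e != set0) -> perfect_matching M ->
  (exists2 S, forcing_set M S & #|S| = forcing_number M) /\
  (forall S, forcing_set M S -> forcing_number M <= #|S|).
Proof.
move=> E0 pM; rewrite /forcing_number.
by case: arg_minnP => [|S fS minS]; [exact: forcing_set_self | split; first by exists S].
Qed.

End Forcing.

Section GeneralizedPetersen.
Variable n : nat.

Definition petersen_vertex : finType := ('I_n + 'I_n)%type.

Definition petersen_u (i : 'I_n) : petersen_vertex := inl i.
Definition petersen_v (i : 'I_n) : petersen_vertex := inr i.

(* ordS is the successor modulo n on 'I_n. *)
Definition petersen2 : {set {set petersen_vertex}} :=
  [set [set petersen_u i; petersen_u (ordS (ordS i))] | i : 'I_n]
  :|: [set [set petersen_u i; petersen_v i] | i : 'I_n]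
  :|: [set [set petersen_v i; petersen_v (ordS i)] | i : 'I_n].

Lemma petersen2_simple (e : {set petersen_vertex}) :
  3 <= n -> e \in petersen2 -> #|e| = 2.
Proof.
move=> n3.
have neq k (i : 'I_n) : 0 < k < n -> (i == (i + k) %% n :> nat) = false.
  case/andP=> k0 kn; rewrite -[X in X == _](modn_small (ltn_ord i)).
  rewrite -[X in X %% n == _]addn0 eqn_modDl mod0n modn_small //.
  by rewrite eq_sym; apply/negbTE; rewrite -lt0n.
case/setUP => [/setUP[]|] /imsetP[i _ ->]; rewrite cards2 //.
- rewrite (inj_eq (@inl_inj _ _)) -val_eqE /=.
  by rewrite -[in X in _ == X]addn1 modnDml addn1 -addn2 (neq 2 i) ?n3.
- rewrite (inj_eq (@inr_inj _ _)) -val_eqE /= -[i.+1]addn1 neq //.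
  exact: leq_trans n3.
Qed.

End GeneralizedPetersen.

(* ceil_div m d is the ceiling of the rational number m / d, for d > 0. *)
Definition ceil_div (m d : nat) : nat := (m + d.-1) %/ d.

Lemma leq_ceil_div m d k : 0 < d -> (ceil_div m d <= k) = (m <= k * d).
Proof.
by case: d => // d _; rewrite /ceil_div /= -ltnS ltn_divLR // mulSn addSn addnC ltnS leq_add2l.
Qed.

Definition delta (n : nat) : nat := if n %% 7 == 3 then 1 else 0.

(* Main.v *)
Require Import Defs.
From HB Require Import structures.
From mathcomp Require Import all_boot zify.

Set Implicit Arguments.
Unset Strict Implicit.
Unset Printing Implicit Defensive.

(** Let a_i, b_i and s_i be the indicators of the edges u_i u_(i+2), v_i v_(i+1)
    and u_i v_i in a perfect matching M. The triple (a_(i-2), a_(i-1), b_(i-1))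
    takes eight values, which fall into two classes of four that never mix, so M is
    a closed walk of length n made of blocks: blocks of sizes 1 and 4 (type [false])
    or of sizes 3 and 4 (type [true]). A set S of edges of M is forcing when no other
    closed walk agrees with S, and all that matters about the part of S met so far
    along M is which pairs of states are joined by a walk that agrees with S and
    differs from M. Minimizing the number of edges for each such relation, and
    dropping dominated relations, gives a dynamic program for the forcing number
    whose tables are, up to an additive constant, only finitely many: 804 for type
    [false] and 596 for type [true]. Potentials on the graph of these tables bound
    the forcing numbers by linear functions of n, and loops in it (of sizes 12 and 4,
    respectively 12 and 7) realize all the values in between. Type [true] gives the
    first interval and type [false] the second. *)

(** * Walks, labels and rival walks *)

Inductive phase := P0 | P1 | P2 | P3.

Definition phase_code p := match p with P0 => 0 | P1 => 1 | P2 => 2 | P3 => 3 end.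

Definition phase_decode n := match n with 0 => P0 | 1 => P1 | 2 => P2 | _ => P3 end.

Lemma phase_codeK : cancel phase_code phase_decode.
Proof. by case. Qed.

HB.instance Definition _ := Equality.copy phase (can_type phase_codeK).

Definition phase_succ p :=
  match p with P0 => P1 | P1 => P2 | P2 => P3 | P3 => P0 end.

(* The phase of a walk is its position inside a block of size 4; a spoke ends a
   block early, at the end of a block of size 1 or 3. *)
Definition spoke_phase (t : bool) := if t then P2 else P0.

Definition is_spoke_phase (t : bool) p :=
  match t, p with true, P2 | false, P0 => true | _, _ => false end.

Definition phase_next p (s : bool) := if s then P0 else phase_succ p.

Definition allowed t p (s : bool) := s ==> is_spoke_phase t p.

(* (a_i, b_i, s_i) *)
Definition label := (bool * bool * bool)%type.

Definition step_label (t : bool) p (s : bool) : label :=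
  if s then (false, false, true) else
  match p with
  | P0 => (~~ t, true, false)
  | P1 => (true, false, false)
  | P2 => (t, true, false)
  | P3 => (false, false, false)
  end.

Definition sublabel (f l : label) : bool :=
  let '(a, b, s) := f in let '(a', b', s') := l in
  [&& a ==> a', b ==> b' & s ==> s'].

Definition label_weight (f : label) : nat := let '(a, b, s) := f in a + b + s.

Definition weight (F : seq label) := sumn (map label_weight F).

Definition endpoint p (w : seq bool) := foldl phase_next p w.

Fixpoint valid t p (w : seq bool) :=
  if w is s :: w' then allowed t p s && valid t (phase_next p s) w' else true.

Fixpoint walk_labels t p (w : seq bool) :=
  if w is s :: w' then step_label t p s :: walk_labels t (phase_next p s) w' else [::].

Definition compat t p w F := valid t p w && all2 sublabel F (walk_labels t p w).

(* The matching under study is the walk [w] of type [tm] from phase [P0], and [F]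
   lists, position by position, the edges of its subset S. *)
Definition forcing tm w F :=
  compat tm P0 w F /\
  forall t p x, compat t p x F -> endpoint p x = p -> (t, p, x) = (tm, P0, w).

(** A competitor may have either type and start at any phase; whether it closes up is decided only
    at the end, by p = q, so every pair of phases is recorded. *)
Definition rival tm w F t p q :=
  exists x, [/\ compat t p x F, endpoint p x = q & (t, p, x) <> (tm, P0, w)].

Lemma endpoint_rcons p w s : endpoint p (rcons w s) = phase_next (endpoint p w) s.
Proof. exact: foldl_rcons. Qed.

Lemma endpoint_cat p v w : endpoint p (v ++ w) = endpoint (endpoint p v) w.
Proof. exact: foldl_cat. Qed.

Lemma valid_cat t p v w : valid t p (v ++ w) = valid t p v && valid t (endpoint p v) w.
Proof. by elim: v p => //= s v IH p; rewrite IH andbA. Qed.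

Lemma size_walk_labels t p w : size (walk_labels t p w) = size w.
Proof. by elim: w p => //= s w IH p; rewrite IH. Qed.

Lemma walk_labels_cat t p v w :
  walk_labels t p (v ++ w) = walk_labels t p v ++ walk_labels t (endpoint p v) w.
Proof. by elim: v p => //= s v IH p; rewrite IH. Qed.

Lemma all2_size (S T : Type) (r : S -> T -> bool) x y : all2 r x y -> size x = size y.
Proof. by elim: x y => [|a x IH] [|b y] //= /andP[_ /IH->]. Qed.

Lemma all2_rcons (S T : Type) (r : S -> T -> bool) x y a b :
  all2 r (rcons x a) (rcons y b) = all2 r x y && r a b.
Proof.
elim: x y => [|c x IH] [|d y] //=; rewrite ?IH ?andbT ?andbA //.
  by case: y => [|e y]; rewrite andbF.
by case: x {IH} => [|e x]; rewrite andbF.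
Qed.

Lemma compat_size t p w F : compat t p w F -> size w = size F.
Proof. by case/andP=> _ /all2_size ->; rewrite size_walk_labels. Qed.

Lemma compat_rcons t p w s F f :
  compat t p (rcons w s) (rcons F f) =
  compat t p w F && (allowed t (endpoint p w) s && sublabel f (step_label t (endpoint p w) s)).
Proof.
rewrite /compat -cats1 valid_cat walk_labels_cat /= andbT cats1 all2_rcons.
by rewrite -!andbA; congr (_ && _); rewrite andbCA.
Qed.

Lemma compat_rconsP t p w F f : compat t p w (rcons F f) ->
  exists w' s, w = rcons w' s.
Proof.
move=> /compat_size; rewrite size_rcons; case/lastP: w => // w s _.
by exists w, s.
Qed.

(** A walk other than [rcons w s] either differs from [w] already or follows [w] and ends with the
    one other letter [~~ s]. So the new relation depends on [w] only through the old one and the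
    phase [endpoint P0 w]. *)
Lemma rivalP tm w s F f t p q :
    compat tm P0 w F ->
  rival tm (rcons w s) (rcons F f) t p q <->
  exists r s', [/\ allowed t r s', sublabel f (step_label t r s'), phase_next r s' = q &
    rival tm w F t p r \/ (t, p, r) = (tm, P0, endpoint P0 w) /\ s' = ~~ s].
Proof.
move=> cw; split.
  case=> x [cx ex nx]; have [x' [s' xE]] := compat_rconsP cx.
  move: cx ex nx; rewrite {}xE compat_rcons endpoint_rcons.
  case/and3P=> cx okx sx ex nx; exists (endpoint p x'), s'; split=> //.
  case: (eqVneq (t, p, x') (tm, P0, w)) => [[tE pE xE]|/eqP nxw].
    subst t p x'; right; split=> //.
    by apply/eqP; move: nx; case: (s) (s') => -[].
  by left; exists x'.
case=> r [s' [okr sr nr]] [[x [cx ex nx]]|[[tE pE rE] s'E]].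
  exists (rcons x s'); split.
  - by rewrite compat_rcons ex cx okr.
  - by rewrite endpoint_rcons ex.
  - by case=> tE pE /rcons_inj[xE _]; apply: nx; rewrite tE pE xE.
subst t p; exists (rcons w s'); split.
- by rewrite compat_rcons cw -rE okr.
- by rewrite endpoint_rcons -rE.
- by case=> /rcons_inj[]; rewrite s'E; case: s {s'E}.
Qed.

(** * Rival relations as Boolean matrices *)

Definition quad (T : Type) := (T * T * T * T)%type.

Definition qget T (x : quad T) p :=
  let '(x0, x1, x2, x3) := x in
  match p with P0 => x0 | P1 => x1 | P2 => x2 | P3 => x3 end.

Definition qmk T (f : phase -> T) : quad T := (f P0, f P1, f P2, f P3).

Definition qmap S T (f : S -> T) (x : quad S) : quad T :=
  let '(x0, x1, x2, x3) := x in (f x0, f x1, f x2, f x3).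

Definition qall2 S T (r : S -> T -> bool) (x : quad S) (y : quad T) :=
  let '(x0, x1, x2, x3) := x in let '(y0, y1, y2, y3) := y in
  if r x0 y0 then if r x1 y1 then if r x2 y2 then r x3 y3 else false else false
  else false.

(* The relation [rival tm w F]: the components are the types [false] and [true],
   each with a row for every starting phase. *)
Definition matrix := (quad (quad bool) * quad (quad bool))%type.

Definition matrix_get (R : matrix) (t : bool) := qget (if t then R.2 else R.1).

Definition matrix_sub (R R' : matrix) : bool :=
  if qall2 (qall2 implb) R.1 R'.1 then qall2 (qall2 implb) R.2 R'.2 else false.

(** Without a spoke the phases rotate, which shifts the columns; a spoke leads to [P0] from a single
    phase. The mask tells from which phases the chosen edges admit the spokeless step. *)
Definition step_row (spk : bool) (mask : quad bool) t (x : quad bool) : quad bool :=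
  let '(x0, x1, x2, x3) := x in let '(m0, m1, m2, m3) := mask in
  ((x3 && m3) || (spk && qget x (spoke_phase t)), x0 && m0, x1 && m1, x2 && m2).

Definition qor0 (b : bool) q (x : quad bool) : quad bool :=
  let '(x0, x1, x2, x3) := x in
  match q with
  | P0 => (b || x0, x1, x2, x3)
  | P1 => (x0, b || x1, x2, x3)
  | P2 => (x0, x1, b || x2, x3)
  | P3 => (x0, x1, x2, b || x3)
  end.

Definition qset0 (g : quad bool -> quad bool) (x : quad (quad bool)) : quad (quad bool) :=
  let '(x0, x1, x2, x3) := x in (g x0, x1, x2, x3).

(** [m] is the current phase of the matching. [dev] inserts the walk that leaves the matching at
    this very letter, so it touches only row [P0] of type [tm]. *)
Definition matrix_step (tm : bool) m s (f : label) (R : matrix) : matrix :=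
  let spk := sublabel f (false, false, true) in
  let step t := qmap (step_row spk (qmk (fun p => sublabel f (step_label t p false))) t) in
  let dev := qset0 (qor0 (allowed tm m (~~ s) && sublabel f (step_label tm m (~~ s)))
                      (phase_next m (~~ s))) in
  let R1 := step false R.1 in let R2 := step true R.2 in
  if tm then (R1, dev R2) else (dev R1, R2).

(** A rival that started like the matching and is again at its phase [m] can follow it to the end,
    so no choice of later edges yields a forcing set. *)
Definition dead tm m (R : matrix) := qget (matrix_get R tm P0) m.

Definition qdiag (x : quad (quad bool)) :=
  let '(x0, x1, x2, x3) := x in
  [|| qget x0 P0, qget x1 P1, qget x2 P2 | qget x3 P3].

Definition nodiag (R : matrix) := ~~ (qdiag R.1 || qdiag R.2).

(** The empty walk joins each phase to itself; it is a rival except from [P0] in type [tm], where it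
    is the matching itself. *)
Definition matrix_init tm : matrix :=
  let I b := (qor0 b P0 (qmk xpred0), qor0 true P1 (qmk xpred0),
              qor0 true P2 (qmk xpred0), qor0 true P3 (qmk xpred0)) in
  (I tm, I (~~ tm)).

Lemma qall2P S T (r : S -> T -> bool) x y :
  reflect (forall p, r (qget x p) (qget y p)) (qall2 r x y).
Proof.
case: x y => [[[x0 x1] x2] x3] [[[y0 y1] y2] y3].
apply: (iffP idP) => [|r01]; first by rewrite /=; do 3! case: ifP => // ?; move=> ? [].
by rewrite /= (r01 P0) (r01 P1) (r01 P2) (r01 P3).
Qed.

Lemma matrix_subP R R' :
  reflect (forall t p q, qget (matrix_get R t p) q -> qget (matrix_get R' t p) q) (matrix_sub R R').
Proof.
have rowP (x y : quad (quad bool)) : reflect (forall p q, qget (qget x p) q -> qget (qget y p) q)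
    (qall2 (qall2 implb) x y).
  apply: (iffP (qall2P _ _ _)) => [H p q|H p].
    by apply/implyP; exact: (qall2P _ _ _ (H p)).
  by apply/qall2P => q; apply/implyP; exact: H.
rewrite /matrix_sub; case: (rowP R.1 R'.1) => [H1|H1]; last first.
  by constructor=> H; apply: H1 => p q; exact: (H false).
apply: (iffP (rowP _ _)) => [H2 [] //|H p q]; exact: (H true).
Qed.

Lemma matrix_get_step tm m s f R t p :
  matrix_get (matrix_step tm m s f R) t p =
  (if (t == tm) && (p == P0)
   then qor0 (allowed tm m (~~ s) && sublabel f (step_label tm m (~~ s)))
          (phase_next m (~~ s)) else id)
  (step_row (sublabel f (false, false, true)) (qmk (fun r => sublabel f (step_label t r false))) t
    (matrix_get R t p)).
Proof.
rewrite /matrix_get /matrix_step; case: R => [[[[a0 a1] a2] a3] [[[b0 b1] b2] b3]].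
by case: tm t p => -[] [].
Qed.

Lemma qget_qor0 b q x r : qget (qor0 b q x) r = (b && (r == q)) || qget x r.
Proof. by case: x => [[[x0 x1] x2] x3]; case: q; case: r; rewrite ?andbT ?andbF. Qed.

Lemma step_rowP t f x q :
  qget (step_row (sublabel f (false, false, true))
          (qmk (fun r => sublabel f (step_label t r false))) t x) q
  <-> exists r s, [/\ allowed t r s, sublabel f (step_label t r s), phase_next r s = q & qget x r].
Proof.
case: x => [[[x0 x1] x2] x3]; split.
  case: q => /=.
  - case/orP => /andP[]; first by exists P3, false.
    by move=> sf xs; exists (spoke_phase t), true; split=> //; case: (t).
  - by case/andP; exists P0, false.
  - by case/andP; exists P1, false.
  - by case/andP; exists P2, false.
case=> r [[] [okr sf <- xr]]; last by case: r {okr} sf xr => /= -> ->.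
by rewrite /= sf; case: t r okr xr {sf} => -[] // _ /= ->; rewrite orbT.
Qed.

Lemma matrix_stepP tm m s f R t p q :
  qget (matrix_get (matrix_step tm m s f R) t p) q <->
  exists r s', [/\ allowed t r s', sublabel f (step_label t r s'), phase_next r s' = q &
    qget (matrix_get R t p) r \/ (t, p, r) = (tm, P0, m) /\ s' = ~~ s].
Proof.
rewrite matrix_get_step; split.
  have old : qget (step_row (sublabel f (false, false, true))
      (qmk (fun r => sublabel f (step_label t r false))) t (matrix_get R t p)) q ->
    exists r s', [/\ allowed t r s', sublabel f (step_label t r s'), phase_next r s' = q &
      qget (matrix_get R t p) r \/ (t, p, r) = (tm, P0, m) /\ s' = ~~ s].
    by case/step_rowP => r [s' [? ? ? ?]]; exists r, s'; split=> //; left.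
  case: ifP => [/andP[/eqP tE /eqP pE]|_ //].
  rewrite qget_qor0 => /orP[/andP[/andP[okm sm] /eqP qE]|//].
  by subst; exists m, (~~ s); split=> //; right.
case=> r [s' [okr sr nr]] [Rr|[[tE pE rE] s'E]].
  have : qget (step_row (sublabel f (false, false, true))
      (qmk (fun r => sublabel f (step_label t r false))) t (matrix_get R t p)) q.
    by apply/step_rowP; exists r, s'.
  by case: ifP => // _; rewrite qget_qor0 => ->; rewrite orbT.
rewrite tE pE !eqxx qget_qor0; apply/orP; left; rewrite -s'E -rE nr eqxx andbT -tE.
by rewrite okr sr.
Qed.

Lemma matrix_initP tm t p q : qget (matrix_get (matrix_init tm) t p) q <-> rival tm [::] [::] t p q.
Proof.
split=> [H|[x [/compat_size/size0nil -> <- nx]]].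
  exists [::]; split=> //; last by case=> tE pE; case: tm t p q tE pE H => -[] // [] // [].
  by case: tm t p q H => -[] [] [].
have: (t, p) <> (tm, P0) by move=> [tE pE]; apply: nx; rewrite tE pE.
by case: tm t p {nx} => -[] [].
Qed.

Lemma nodiagP R : reflect (forall t p, ~~ qget (matrix_get R t p) p) (nodiag R).
Proof.
rewrite /nodiag /matrix_get; case: R => [[[[a0 a1] a2] a3] [[[b0 b1] b2] b3]].
apply: (iffP norP) => [|H].
  case=> /norP[? /norP[? /norP[? ?]]] /norP[? /norP[? /norP[? ?]]].
  by case=> -[].
rewrite /= !negb_or (H false P0) (H false P1) (H false P2) (H false P3).
by rewrite (H true P0) (H true P1) (H true P2) (H true P3).
Qed.

(** * The dynamic program on tables of costs and relations *)

Definition entry := (nat * matrix)%type.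

(* The conditionals here and below stand for boolean connectives, which would
   evaluate both arguments under [vm_compute]. *)
Fixpoint lazy_has T (a : pred T) s :=
  if s is x :: s' then if a x then true else lazy_has a s' else false.

Definition dominates (x y : entry) := if x.1 <= y.1 then matrix_sub x.2 y.2 else false.

Definition bool_cmp (b c : bool) :=
  match b, c with true, false => Gt | false, true => Lt | _, _ => Eq end.

Definition quad_cmp T (cmp : T -> T -> comparison) (x y : quad T) :=
  let '(x0, x1, x2, x3) := x in let '(y0, y1, y2, y3) := y in
  match cmp x0 y0 with Eq =>
    match cmp x1 y1 with Eq =>
      match cmp x2 y2 with Eq => cmp x3 y3 | c => c end
    | c => c end
  | c => c end.

Definition matrix_cmp (R R' : matrix) :=
  match quad_cmp (quad_cmp bool_cmp) R.1 R'.1 with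
  | Eq => quad_cmp (quad_cmp bool_cmp) R.2 R'.2
  | c => c end.

(* Sorting puts dominating entries first and makes the pruned list canonical, so
   that equal sets of entries are recognized as equal lists. *)
Definition entry_le (x y : entry) :=
  if x.1 < y.1 then true else if x.1 == y.1 then
    if matrix_cmp x.2 y.2 is Gt then false else true
  else false.

Definition prune1 kept (x : entry) :=
  if lazy_has (dominates^~ x) kept then kept else x :: kept.

Definition prune (l : seq entry) := foldl prune1 [::] (sort entry_le l).

Definition sublabels (l : label) : seq label :=
  [seq f <- [seq (ab, s) | ab <- [seq (a, b) | a <- [:: false; true], b <- [:: false; true]],
                           s <- [:: false; true]] | sublabel f l].

Definition extend_entry tm m s (x : entry) (wf : nat * label) : option entry :=
  let R := matrix_step tm m s wf.2 x.2 in
  if dead tm (phase_next m s) R then None else Some (wf.1 + x.1, R).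

Definition extend tm m s (d : seq entry) : seq entry :=
  let o := [seq (label_weight f, f) | f <- sublabels (step_label tm m s)] in
  prune (flatten [seq pmap (extend_entry tm m s x) o | x <- d]).

Fixpoint extends tm m w d :=
  if w is s :: w' then extends tm (phase_next m s) w' (extend tm m s d) else d.

Definition block (tm c : bool) :=
  if c then if tm then [:: false; false; true] else [:: true] else nseq 4 false.

Definition blocks tm (u : seq bool) := flatten (map (block tm) u).

Definition seq_min (l : seq nat) := foldr minn (head 0 l) l.

Definition state := (nat * seq entry)%type.

Definition normalize (d : seq entry) : state :=
  let k := seq_min (map fst d) in (k, [seq (x.1 - k, x.2) | x <- d]).

Definition extend_block tm d c := normalize (extends tm P0 (block tm c) d).

Definition step tm (x : state) c : state :=
  let y := extend_block tm x.2 c in (x.1 + y.1, y.2).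

Definition init tm : seq entry := [:: (0, matrix_init tm)].

Definition run tm u := foldl (step tm) (0, init tm) u.

Definition costs (d : seq entry) : seq nat := [seq x.1 | x <- d & nodiag x.2].

Definition value (x : state) := x.1 + seq_min (costs x.2).

(** Soundness turns an entry into an edge set of exactly its cost with no more rivals; completeness,
    below, turns an edge set that is still live into an entry with no larger cost and no more
    rivals. Both survive the removal of dominated entries. *)
Definition sound tm w off (d : seq entry) :=
  forall x, x \in d -> exists F, [/\ compat tm P0 w F, weight F = x.1 + off &
    forall t p q, rival tm w F t p q -> qget (matrix_get x.2 t p) q].

Definition complete tm w off (d : seq entry) :=
  forall F, compat tm P0 w F -> ~ rival tm w F tm P0 (endpoint P0 w) ->
  exists x, [/\ x \in d, x.1 + off <= weight F &
    forall t p q, qget (matrix_get x.2 t p) q -> rival tm w F t p q].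

Lemma lazy_hasE T (a : pred T) s : lazy_has a s = has a s.
Proof. by elim: s => //= x s ->. Qed.

Lemma prune_sub l : {subset prune l <= l}.
Proof.
move=> y; rewrite -(mem_sort entry_le l) /prune.
have gen acc s : y \in foldl prune1 acc s -> (y \in acc) || (y \in s).
  elim: s acc => [|x s IH] acc /=; first by rewrite orbF.
  move/IH; rewrite /prune1 inE; case: ifP => _; rewrite ?inE.
    by case/orP => ->; rewrite ?orbT.
  by rewrite -orbA orbCA.
by move=> yl; exact: (gen _ _ yl).
Qed.

Lemma dominates_refl x : dominates x x.
Proof. by rewrite /dominates leqnn; apply/matrix_subP. Qed.

Lemma prune_dominates l x : x \in l -> exists2 y, y \in prune l & dominates y x.
Proof.
rewrite -(mem_sort entry_le l) /prune.
have keep acc s y : y \in acc -> y \in foldl prune1 acc s.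
  elim: s acc => //= z s IH acc yacc; apply: IH.
  by rewrite /prune1; case: ifP; rewrite ?inE ?yacc ?orbT.
elim: (sort _ _) [::] => //= z s IH acc; rewrite inE => /orP[/eqP->|/IH//].
rewrite /prune1 lazy_hasE; case: ifP => [/hasP[y yacc dy]|_].
  by exists y => //; apply: keep.
by exists z; [apply: keep; rewrite mem_head | exact: dominates_refl].
Qed.

Lemma sublabelsP f l : (f \in sublabels l) = sublabel f l.
Proof. by rewrite mem_filter; case: (sublabel f l) => //; case: f => [[[] []] []]. Qed.

Lemma weight_rcons F f : weight (rcons F f) = weight F + label_weight f.
Proof. by rewrite /weight map_rcons sumn_rcons. Qed.

Lemma valid_rcons t p w s : valid t p (rcons w s) = valid t p w && allowed t (endpoint p w) s.
Proof. by rewrite -cats1 valid_cat /= andbT. Qed.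

Lemma mem_candidates tm m s d y :
  y \in flatten [seq pmap (extend_entry tm m s x)
                   [seq (label_weight f, f) | f <- sublabels (step_label tm m s)] | x <- d] ->
  exists x f, [/\ x \in d, sublabel f (step_label tm m s) &
    y = (label_weight f + x.1, matrix_step tm m s f x.2)].
Proof.
case/flattenP=> l /mapP[x xd ->]; rewrite mem_pmap => /mapP[_ /mapP[f fo ->]].
rewrite sublabelsP in fo; rewrite /extend_entry; case: ifP => // _ [->].
by exists x, f.
Qed.

Lemma extend_sound tm w s off d :
  allowed tm (endpoint P0 w) s -> sound tm w off d ->
  sound tm (rcons w s) off (extend tm (endpoint P0 w) s d).
Proof.
move=> oks sd y /prune_sub /mem_candidates[x [f [xd sf ->]]].
have [F [cF tF aF]] := sd x xd; exists (rcons F f); split.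
- by rewrite compat_rcons cF oks sf.
- by rewrite weight_rcons tF /= addnC addnA.
- move=> t p q /(rivalP _ _ _ _ _ cF)[r [s' [? ? ? rel]]]; apply/matrix_stepP; exists r, s'.
  by split=> //; case: rel => [/aF|]; [left | right].
Qed.

Lemma extend_complete tm w s off d :
  valid tm P0 (rcons w s) -> complete tm w off d ->
  complete tm (rcons w s) off (extend tm (endpoint P0 w) s d).
Proof.
move=> vw cd G; case/lastP: G => [|F f].
  by move/compat_size; rewrite size_rcons.
rewrite compat_rcons endpoint_rcons => /and3P[cF oks sf] live.
have [|x [xd xF xalt]] := cd F cF.
  (* A rival that has rejoined the matching copies its letter [s], so a dead prefix stays dead. *)
  move=> dF; apply: live; apply/(rivalP _ _ _ _ _ cF).
  by exists (endpoint P0 w), s; split=> //; left.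
have yalt t p q : qget (matrix_get (matrix_step tm (endpoint P0 w) s f x.2) t p) q ->
    rival tm (rcons w s) (rcons F f) t p q.
  case/matrix_stepP=> r [s' [? ? ? rel]]; apply/(rivalP _ _ _ _ _ cF); exists r, s'.
  by split=> //; case: rel => [/xalt|]; [left | right].
have /prune_dominates[y yd] : (label_weight f + x.1, matrix_step tm (endpoint P0 w) s f x.2) \in
    flatten [seq pmap (extend_entry tm (endpoint P0 w) s z)
                 [seq (label_weight f, f) | f <- sublabels (step_label tm (endpoint P0 w) s)] | z <- d].
  apply/flattenP; eexists; first by apply: map_f xd.
  rewrite mem_pmap; apply/mapP; exists (label_weight f, f).
    by apply: map_f; rewrite sublabelsP.
  by rewrite /extend_entry ifF //; apply/negP => /yalt.
rewrite /dominates; case: ifP => //= le_y /matrix_subP sub_y; exists y; split=> //.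
  rewrite weight_rcons; apply: leq_trans (_ : label_weight f + x.1 + off <= _).
    by rewrite leq_add2r.
  by rewrite -addnA addnC leq_add2r.
by move=> t p q /sub_y/yalt.
Qed.

Lemma extends_correct tm w v off d :
    valid tm P0 (w ++ v) -> sound tm w off d -> complete tm w off d ->
  sound tm (w ++ v) off (extends tm (endpoint P0 w) v d) /\
  complete tm (w ++ v) off (extends tm (endpoint P0 w) v d).
Proof.
elim: v w d => [|s v IH] w d /=; first by rewrite cats0.
rewrite -cat_rcons => vw sd cd; rewrite -endpoint_rcons.
have vws : valid tm P0 (rcons w s) by move: vw; rewrite valid_cat => /andP[].
apply: IH => //; last exact: extend_complete.
by apply: extend_sound => //; move: vws; rewrite valid_rcons => /andP[].
Qed.

Lemma seq_min_le l x : x \in l -> seq_min l <= x.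
Proof.
rewrite /seq_min; elim: l (head 0 l) => //= y l IH h.
rewrite inE => /orP[/eqP->|/(IH h)]; first exact: geq_minl.
exact: leq_trans (geq_minr _ _).
Qed.

Lemma mem_seq_min l : l != [::] -> seq_min l \in l.
Proof.
case: l => // x l _; rewrite /seq_min -[head _ _]/x.
have mem_foldr : forall l' h, foldr minn h l' \in h :: l'.
  move=> l' h; elim: l' => [|y l' IH] /=; first by rewrite mem_head.
  rewrite /minn; case: ifP => _; first by rewrite !inE eqxx orbT.
  by move: IH; rewrite !inE => /orP[]->; rewrite ?orbT.
by have := mem_foldr (x :: l) x; rewrite in_cons => /orP[/eqP e|//]; rewrite {1}e mem_head.
Qed.

Lemma normalize_correct tm w off d :
    sound tm w off d -> complete tm w off d ->
  sound tm w (off + (normalize d).1) (normalize d).2 /\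
  complete tm w (off + (normalize d).1) (normalize d).2.
Proof.
move=> sd cd; rewrite /normalize /=; set k := seq_min _.
have kx x : x \in d -> x.1 - k + (off + k) = x.1 + off.
  by move=> xd; rewrite addnCA addnC subnK // seq_min_le // map_f.
split=> [_ /mapP[x xd ->]|F cF live].
  by have [F [? tF ?]] := sd x xd; exists F; split=> //; rewrite tF /= kx.
have [x [xd xF ?]] := cd F cF live; exists (x.1 - k, x.2).
by split=> //; [apply: (map_f (fun x : entry => (x.1 - k, x.2)) xd) | rewrite /= kx].
Qed.

Lemma blocks_cat tm u v : blocks tm (u ++ v) = blocks tm u ++ blocks tm v.
Proof. by rewrite /blocks map_cat flatten_cat. Qed.

Lemma blocks_rcons tm u c : blocks tm (rcons u c) = blocks tm u ++ block tm c.
Proof. by rewrite -cats1 blocks_cat /blocks /= cats0. Qed.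

Lemma endpoint_blocks tm u : endpoint P0 (blocks tm u) = P0.
Proof.
elim/last_ind: u => // u c IH; rewrite blocks_rcons endpoint_cat IH.
by case: tm {IH} c => -[].
Qed.

Lemma valid_blocks tm u : valid tm P0 (blocks tm u).
Proof.
elim/last_ind: u => // u c IH; rewrite blocks_rcons valid_cat IH endpoint_blocks.
by case: tm {IH} c => -[].
Qed.

Lemma run_rcons tm u c : run tm (rcons u c) = step tm (run tm u) c.
Proof. exact: foldl_rcons. Qed.

Lemma run_correct tm u :
  sound tm (blocks tm u) (run tm u).1 (run tm u).2 /\
  complete tm (blocks tm u) (run tm u).1 (run tm u).2.
Proof.
elim/last_ind: u => [|u c [su cu]].
  split=> [x|F].
    rewrite mem_seq1 => /eqP->; exists [::]; split=> //.
    by move=> t p q /matrix_initP.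
  move=> /compat_size/esym/size0nil-> _; exists (0, matrix_init tm); split=> //.
  by rewrite mem_head.
  by move=> t p q /matrix_initP.
rewrite run_rcons /step /extend_block.
have := valid_blocks tm (rcons u c); rewrite blocks_rcons => vuc.
have [suc cuc] := extends_correct vuc su cu.
rewrite endpoint_blocks in suc cuc.
exact: normalize_correct.
Qed.

(** A closed walk starts and ends in the same phase, so forcing is the absence of diagonal pairs,
    which [nodiag] tests in the final table. *)
Lemma rival_closed tm w F :
  endpoint P0 w = P0 -> compat tm P0 w F ->
  (forall t p, ~ rival tm w F t p p) <-> forcing tm w F.
Proof.
move=> ew cF; split=> [na|[_ fF] t p [x [cx ex]]]; last by apply; exact: fF.
split=> // t p x cx ex; apply/eqP/negPn/negP => /eqP nx.
by apply: (na t p); exists x.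
Qed.

(** Completeness gives the lower bound and soundness a set attaining it. The assumed forcing set
    makes [costs] nonempty, so the default 0 of [seq_min] does not occur. *)
Lemma value_correct tm u :
    (exists F, forcing tm (blocks tm u) F) ->
  (exists2 F, forcing tm (blocks tm u) F & weight F = value (run tm u)) /\
  (forall F, forcing tm (blocks tm u) F -> value (run tm u) <= weight F).
Proof.
have [su cu] := run_correct tm u; have eu := endpoint_blocks tm u.
have low F : forcing tm (blocks tm u) F ->
    exists2 k, k \in costs (run tm u).2 & (run tm u).1 + k <= weight F.
  move=> fF; have cF := fF.1; have na := (rival_closed eu cF).2 fF.
  have [|x [xd xF xalt]] := cu F cF; first by rewrite eu; exact: na.
  exists x.1; last by rewrite addnC.
  apply: map_f; rewrite mem_filter xd andbT; apply/nodiagP => t p.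
  by apply/negP => /xalt /na.
move=> [F0 /low[k0 k0d _]]; split=> [|F /low[k kd]]; last first.
  by apply: leq_trans; rewrite leq_add2l seq_min_le.
have : seq_min (costs (run tm u).2) \in costs (run tm u).2.
  by apply: mem_seq_min; apply: contraTneq k0d => ->.
case/mapP=> x; rewrite mem_filter => /andP[/nodiagP nd xd] xE.
have [F [cF tF aF]] := su x xd; exists F; last by rewrite tF /value xE addnC.
apply/(rival_closed eu cF) => t p /aF; exact/negP.
Qed.

(** * The graph of tables and its certified potentials *)

Fixpoint lazy_eq T (e : T -> T -> bool) (x y : seq T) :=
  match x, y with
  | [::], [::] => true
  | a :: x', b :: y' => if e a b then lazy_eq e x' y' else false
  | _, _ => false
  end.

Definition matrix_eq (R R' : matrix) :=
  if qall2 (qall2 eqb) R.1 R'.1 then qall2 (qall2 eqb) R.2 R'.2 else false.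

Definition entry_eq (x y : entry) := if x.1 == y.1 then matrix_eq x.2 y.2 else false.

Definition dict_eq := lazy_eq entry_eq.

(* Tables of the dynamic program, each with its two successors. *)
Definition graph := seq (seq entry * seq state).

Definition successors tm d := [seq extend_block tm d c | c <- [:: true; false]].

Fixpoint search tm fuel (seen : graph) (todo : seq (seq entry)) : graph :=
  if fuel is fuel'.+1 then
    if todo is d :: todo' then
      let ys := successors tm d in
      let fresh := foldl (fun new y =>
        if lazy_has (dict_eq y.2) new then new
        else if lazy_has (fun x => dict_eq y.2 x.1) seen then new
        else if lazy_has (dict_eq y.2) todo then new else rcons new y.2) [::] ys in
      search tm fuel' ((d, ys) :: seen) (todo' ++ fresh)
    else seen
  else seen.

(** The fuel 1000 exceeds the number of tables of either type. *)
Definition full_graph tm := search tm 1000 [::] [:: init tm].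

Definition table tm (g : graph) : seq (seq (nat * nat * nat)) :=
  let ns := unzip1 g in
  [seq [seq (size (block tm y.1), y.2.1, find (dict_eq y.2.2) ns)
       | y <- zip [:: true; false] x.2] | x <- g].

Definition finals (ns : seq (seq entry)) := [seq seq_min (costs d) | d <- ns].

(** The ends of the intervals with ceilings cleared: n + 12 <= 12k for ceil(n/12) + 1 <= k, n + 2 <=
    6k for ceil((n+2)/6) <= k, and 4k <= n + 3 for k <= ceil(n/4). *)
Definition lower_slope (tm : bool) := if tm then 12 else 6.
Definition lower_shift (tm : bool) := if tm then 12 else 2.
Definition upper_slope (tm : bool) := if tm then 7 else 4.
Definition modulus (tm : bool) := if tm then 7 else 1.
(* [7 * k <= n + upper_shift true (n %% 7)] says that [k] is at most the upper end of
   the first interval. *)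
Definition upper_shift (tm : bool) r :=
  nth 0 (if tm then [:: 7; 6; 5; 11; 3; 9; 8] else [:: 3]) r.

Definition within tm n k :=
  (n + lower_shift tm <= lower_slope tm * k) &&
  (upper_slope tm * k <= n + upper_shift tm (n %% modulus tm)).

(* Potentials are shifted by 40, which makes all of them nonnegative. *)
Definition lower_update tm (tab : seq (seq (nat * nat * nat))) fs (lo : seq nat) :=
  [seq foldr maxn (40 + lower_shift tm - lower_slope tm * x.2)
         [seq nth 0 lo e.2 + e.1.1 - lower_slope tm * e.1.2 | e <- x.1]
  | x <- zip tab fs].

Definition upper_update tm (tab : seq (seq (nat * nat * nat))) fs (hi : seq (seq nat)) :=
  [seq let out := [seq (e.1, nth [::] hi e.2) | e <- x.1] in
       [seq foldr minn (40 + upper_shift tm r - upper_slope tm * x.2)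
              [seq nth 0 e.2 ((r + e.1.1) %% modulus tm) + e.1.1 - upper_slope tm * e.1.2
              | e <- out]
       | r <- iota 0 (modulus tm)]
  | x <- zip tab fs].

(** Value iteration, here and in [upper_potential], for the extreme of shift plus length minus slope
    times cost over all continuations from a table. The start values 0 and 99 stand for minus and
    plus infinity; that twelve rounds suffice is confirmed by [check_node]. *)
Definition lower_potential tm tab (fs : seq nat) :=
  iter 12 (lower_update tm tab fs) (nseq (size fs) 0).

Definition upper_potential tm tab (fs : seq nat) :=
  iter 12 (upper_update tm tab fs) (nseq (size fs) (nseq (modulus tm) 99)).

(** These inequalities carry the bounds of [check_bounds] along every edge and make them imply
    [within] at every table. The upper potential depends on the length modulo 7 for type [true], as
    the upper end of the first interval does. *)
Definition check_node tm tab fs lo hi i :=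
  let l := nth 0 lo i in let h := nth [::] hi i in let f := nth 0 fs i in
  [&& 40 + lower_shift tm <= lower_slope tm * f + l,
    all (fun r => upper_slope tm * f + nth 0 h r <= 40 + upper_shift tm r)
      (iota 0 (modulus tm)) &
    all (fun e : nat * nat * nat => let h' := nth [::] hi e.2 in
      [&& e.2 < size fs, nth 0 lo e.2 + e.1.1 <= lower_slope tm * e.1.2 + l &
        all (fun r => upper_slope tm * e.1.2 + nth 0 h r <=
          nth 0 h' ((r + e.1.1) %% modulus tm) + e.1.1)
        (iota 0 (modulus tm))]) (nth [::] tab i)].

Definition check_bounds tm lo hi i off len :=
  (len + nth 0 lo i <= lower_slope tm * off + 40) &&
  (upper_slope tm * off + 40 <= len + nth 0 (nth [::] hi i) (len %% modulus tm)).

(** The bounds fail for very short words such as the empty one, so all words are followed until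
    their size is at least 10 and the potentials take over. Ten rounds suffice, since blocks have
    positive size. *)
Fixpoint check_start tm ns lo hi fuel (x : state) len :=
  if 10 <= len then
    let i := find (dict_eq x.2) ns in (i < size ns) && check_bounds tm lo hi i x.1 len
  else if fuel is fuel'.+1 then
    all (fun c => check_start tm ns lo hi fuel' (step tm x c) (len + size (block tm c)))
      [:: true; false]
  else false.

Definition check tm ns tab fs lo hi :=
  all (check_node tm tab fs lo hi) (iota 0 (size fs)) &&
  check_start tm ns lo hi 10 (0, init tm) 0.

Definition certificate tm :=
  let g := full_graph tm in let ns := unzip1 g in
  let tab := table tm g in let fs := finals ns in
  check tm ns tab fs (lower_potential tm tab fs) (upper_potential tm tab fs).

(** Settled by evaluating the search together with all its checks. *)
Lemma certificate_true tm : certificate tm.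
Proof. by case: tm; vm_cast_no_check (erefl true). Qed.

Lemma lazy_eqP T (e : T -> T -> bool) (x y : seq T) :
  (forall a b, e a b -> a = b) -> lazy_eq e x y -> x = y.
Proof.
by move=> eP; elim: x y => [|a x IH] [|b y] //=; case: ifP => // /eP-> /IH->.
Qed.

Lemma qget_inj T (x y : quad T) : qget x =1 qget y -> x = y.
Proof.
case: x y => [[[x0 x1] x2] x3] [[[y0 y1] y2] y3] H.
by have := (H P0, H P1, (H P2, H P3)) => /= -[[-> ->] [-> ->]].
Qed.

Lemma matrix_eqP R R' : matrix_eq R R' -> R = R'.
Proof.
have rowP (x y : quad (quad bool)) : qall2 (qall2 eqb) x y -> x = y.
  move/qall2P=> H; apply: qget_inj => p; apply: qget_inj => q.
  by apply/eqP; exact: (qall2P _ _ _ (H p)).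
by case: R R' => [A B] [A' B']; rewrite /matrix_eq /=; case: ifP => // /rowP-> /rowP->.
Qed.

Lemma dict_eqP d d' : dict_eq d d' -> d = d'.
Proof.
apply: lazy_eqP => -[k R] [k' R']; rewrite /entry_eq /=.
by case: eqP => // -> /matrix_eqP ->.
Qed.

Lemma find_dict ns d : find (dict_eq d) ns < size ns ->
  nth [::] ns (find (dict_eq d) ns) = d.
Proof. by rewrite -has_find => /(nth_find [::])/dict_eqP. Qed.

(** All that is proved of the search is that recorded successors are correct. That each of them is
    again a node is tested by [check_node] through its index. *)
Definition complete_graph tm (g : graph) :=
  forall x, x \in g -> x.2 = successors tm x.1.

Lemma search_complete tm fuel seen todo :
  complete_graph tm seen -> complete_graph tm (search tm fuel seen todo).
Proof.
elim: fuel seen todo => [//|fuel IH] seen [//|d todo] seenP.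
by refine (IH _ _ _) => x; rewrite inE => /orP[/eqP->|/seenP].
Qed.

Section Certificate.

Variables (tm : bool) (g : graph) (lo : seq nat) (hi : seq (seq nat)).
Hypothesis gP : complete_graph tm g.
Let ns := unzip1 g.
Hypothesis nodes_ok :
  all (check_node tm (table tm g) (finals ns) lo hi) (iota 0 (size (finals ns))).

Definition located (x : state) len :=
  exists i, [/\ i < size ns, nth [::] ns i = x.2 & check_bounds tm lo hi i x.1 len].

Lemma check_nodeP i :
  i < size ns -> check_node tm (table tm g) (finals ns) lo hi i.
Proof. by move=> i_lt; apply: (allP nodes_ok); rewrite mem_iota size_map. Qed.

Lemma mod_iota len : len %% modulus tm \in iota 0 (modulus tm).
Proof. by rewrite mem_iota ltn_mod; case: (tm). Qed.

Lemma table_mem i c : i < size ns ->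
  let y := extend_block tm (nth [::] ns i) c in
  (size (block tm c), y.1, find (dict_eq y.2) ns) \in nth [::] (table tm g) i.
Proof.
rewrite size_map => i_lt; have x0 : seq entry * seq state := ([::], [::]).
rewrite (nth_map x0) // (nth_map x0) // gP ?mem_nth //.
rewrite /successors; move: (extend_block tm) => ext.
by case: c; rewrite /= !inE eqxx ?orbT.
Qed.

Lemma located_step x len c :
  located x len -> located (step tm x c) (len + size (block tm c)).
Proof.
move=> [i [i_lt nsi /andP[lo_i hi_i]]].
have /and3P[_ _ /allP/(_ _ (table_mem c i_lt))] := check_nodeP i_lt.
rewrite /= nsi size_map => /and3P[e_lt lo_e /allP/(_ _ (mod_iota len)) hi_r].
exists (find (dict_eq (extend_block tm x.2 c).2) ns); split=> //.
  by rewrite find_dict.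
rewrite modnDml in hi_r; rewrite /check_bounds /= !mulnDr.
apply/andP; split; move: lo_i hi_i lo_e hi_r; clear; lia.
Qed.

Lemma located_value x len : located x len -> within tm len (value x).
Proof.
move=> [i [i_lt nsi /andP[lo_i hi_i]]].
have /and3P[] := check_nodeP i_lt.
rewrite (nth_map [::]) // nsi => lo_f /allP/(_ _ (mod_iota len)) hi_r _.
rewrite /within /value !mulnDr.
apply/andP; split; move: lo_i hi_i lo_f hi_r; clear; lia.
Qed.

Lemma located_later x len v : located x len ->
  within tm (len + size (blocks tm v)) (value (foldl (step tm) x v)).
Proof.
elim: v x len => [|c v IH] x len loc; first by rewrite addn0; exact: located_value.
by rewrite size_cat addnA; apply: IH; exact: located_step.
Qed.

Lemma check_startP fuel x len v : check_start tm ns lo hi fuel x len ->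
  10 <= len + size (blocks tm v) ->
  within tm (len + size (blocks tm v)) (value (foldl (step tm) x v)).
Proof.
have here y l : (find (dict_eq y.2) ns < size ns) &&
    check_bounds tm lo hi (find (dict_eq y.2) ns) y.1 l -> located y l.
  by case/andP=> i_lt bnd; eexists; split; [exact: i_lt | exact: find_dict |].
elim: fuel x len v => [|fuel IH] x len v /=; case: ifP => // len10.
- by move=> /here loc _; exact: located_later.
- by move=> /here loc _; exact: located_later.
- rewrite andbT => /andP[st sf]; case: v => [|c v]; first by rewrite addn0 len10.
  rewrite size_cat addnA; case: c => /=; exact: IH.
Qed.

End Certificate.

Lemma check_run tm g lo hi u : complete_graph tm g ->
  check tm (unzip1 g) (table tm g) (finals (unzip1 g)) lo hi ->
  10 <= size (blocks tm u) -> within tm (size (blocks tm u)) (value (run tm u)).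
Proof.
move=> gP /andP[nodes_ok start_ok].
by rewrite /run; exact: (check_startP gP nodes_ok start_ok).
Qed.

Lemma value_within tm u :
  10 <= size (blocks tm u) -> within tm (size (blocks tm u)) (value (run tm u)).
Proof.
have := certificate_true tm; rewrite /certificate; cbv zeta.
have : complete_graph tm (full_graph tm) by apply: search_complete.
move: (full_graph tm) => g gP.
move: (lower_potential _ _ _) (upper_potential _ _ _) => lo hi.
exact: check_run.
Qed.

(** * Realizing values by words with loops *)

Definition realizable tm n k :=
  exists u, size (blocks tm u) = n /\ value (run tm u) = k.

Definition loop_cost tm (d : seq entry) l : option nat :=
  let x := foldl (step tm) (0, d) l in if dict_eq x.2 d then Some x.1 else None.

(** A quintuple (u, l, v, l', w) stands for the words u l^a v l'^b w, where l and l' each return to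
    the table from which they start. *)
Definition family := (seq bool * seq bool * seq bool * seq bool * seq bool)%type.

Definition family_data tm (h : family) : option ((nat * nat) * (nat * nat) * (nat * nat)) :=
  let '(u, l, v, l', w) := h in
  let x := run tm u in let y := foldl (step tm) x v in let z := foldl (step tm) y w in
  if loop_cost tm x.2 l is Some c then
    if loop_cost tm y.2 l' is Some c' then
      Some ((size (blocks tm (u ++ v ++ w)), value z),
            (size (blocks tm l), c), (size (blocks tm l'), c'))
    else None
  else None.

Lemma steps_shift tm a x u :
  foldl (step tm) (a + x.1, x.2) u =
  (a + (foldl (step tm) x u).1, (foldl (step tm) x u).2).
Proof. by elim: u x => //= c u IH x; rewrite -IH /step /= addnA. Qed.

Lemma loop_costP tm x l c k :
  loop_cost tm x.2 l = Some c ->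
  foldl (step tm) x (flatten (nseq k l)) = (k * c + x.1, x.2).
Proof.
rewrite /loop_cost; case: ifP => // /dict_eqP e [cE].
have {}cE y : y.2 = x.2 -> foldl (step tm) y l = (c + y.1, x.2).
  case: y => a d /= ->; rewrite -[in LHS](addn0 a) (steps_shift _ a (0, x.2)).
  by rewrite e cE addnC.
suff gen y : y.2 = x.2 -> foldl (step tm) y (flatten (nseq k l)) = (k * c + y.1, x.2).
  exact: gen.
elim: k y => [|k IH] y yx /=; first by rewrite -yx; case: (y).
by rewrite foldl_cat cE // IH //= mulSn addnCA addnA.
Qed.

Lemma size_blocks_nseq tm k l :
  size (blocks tm (flatten (nseq k l))) = k * size (blocks tm l).
Proof. by elim: k => //= k IH; rewrite blocks_cat size_cat IH mulSn. Qed.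

Lemma family_realizable tm h n0 k0 n1 k1 n2 k2 a b :
  family_data tm h = Some ((n0, k0), (n1, k1), (n2, k2)) ->
  realizable tm (n0 + a * n1 + b * n2) (k0 + a * k1 + b * k2).
Proof.
case: h => [[[[u l] v] l'] w]; rewrite /family_data.
case l1: loop_cost => [c|//]; case l2: loop_cost => [c'|//].
case=> <- <- <- <- <- <-.
exists (u ++ flatten (nseq a l) ++ v ++ flatten (nseq b l') ++ w); split.
  by rewrite !blocks_cat !size_cat !size_blocks_nseq; lia.
rewrite /run foldl_cat -/(run tm u) foldl_cat (loop_costP a l1).
rewrite foldl_cat steps_shift foldl_cat.
rewrite (@loop_costP tm (a * c + _, _) l' c' b l2) /= addnA steps_shift.
by rewrite /value /=; lia.
Qed.

Definition word := map (fun k => k != 4).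

(* The words below are written by listing block sizes. *)
Definition families (tm : bool) : seq family :=
  let fam u l v l' w := (word u, word l, word v, word l', word w) in
  if tm then
    [:: fam [:: 3; 4; 4; 3] (nseq 4 3) [::] [:: 4; 3] [::];
        fam (nseq 4 3) (nseq 4 3) [:: 4] [:: 3; 4] [::];
        fam [:: 3; 3; 4; 4; 3] (nseq 4 3) [::] [:: 4; 3] [::];
        fam [:: 3; 4; 4; 3] (nseq 4 3) [:: 4] [:: 3; 4] [::];
        fam (nseq 5 3) (nseq 4 3) [:: 4] [:: 3; 4] [::];
        fam (nseq 4 3) (nseq 4 3) [:: 4] [:: 3; 4] [:: 4];
        fam [:: 3; 3; 4; 3; 3] (nseq 4 3) [:: 4] [:: 3; 4] [::];
        fam [:: 3; 4; 4; 3] (nseq 4 3) [:: 4] [:: 3; 4] [:: 4];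
        fam [:: 4; 4; 3; 3] (nseq 4 3) [:: 4] [:: 3; 4] [:: 4];
        fam (nseq 5 3) (nseq 4 3) [:: 4] [:: 3; 4] [:: 4];
        fam [:: 3; 4; 4; 3; 4; 4; 3] (nseq 4 3) [:: 4] [:: 3; 4] [:: 4];
        fam [:: 3; 3; 4; 3; 3; 4; 3; 3; 4; 3; 3] (nseq 4 3) [:: 4] [:: 3; 4] [::];
        fam (nseq 4 3) (nseq 4 3) [::] [::] [::];
        fam [:: 3; 3; 4; 3; 4] [::] [::] [:: 3; 4] [::]]
  else
    [seq fam u [:: 1; 1; 1; 4; 1; 4] [::] [:: 4] [::] | u <-
      [:: nseq 4 1 ++ [:: 4; 4]; nseq 5 1 ++ [:: 4; 4]; nseq 6 1 ++ [:: 4; 4];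
          nseq 7 1 ++ [:: 4; 4]; nseq 7 1 ++ [:: 4; 1; 4];
          [:: 1; 1; 1; 4; 1; 4; 1; 4; 4]; [:: 1; 1; 1; 4; 4; 1; 1; 1; 4; 4]]]
    ++ [seq fam (nseq k 1) [::] [::] (nseq 4 1) [::] | k <- [:: 9; 10; 11]].

(** Starting pairs of size and value from which the two loops fill all of [core] for n >= 34. *)
Definition heads (tm : bool) : seq (nat * nat) :=
  if tm then [:: (14, 3); (16, 3); (17, 3); (18, 3); (19, 3); (20, 3); (20, 4);
                 (22, 3); (22, 4); (23, 3); (33, 4); (40, 7)]
  else [:: (12, 3); (13, 3); (14, 3); (15, 3); (16, 3); (21, 4); (22, 4)].

Definition long_cost (tm : bool) := if tm then 1 else 2.
Definition short_size (tm : bool) := if tm then 7 else 4.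

(* The size and value of the word without its loops, then the size and cost of each loop. *)
Definition family_list tm :=
  [seq Some (h, (12, long_cost tm), (short_size tm, 1)) | h <- heads tm] ++
  if tm then [:: Some ((12, 2), (12, 1), (0, 0)); Some ((17, 4), (0, 0), (7, 1))]
  else [seq Some ((k, 3), (0, 0), (4, 1)) | k <- [:: 9; 10; 11]].

Lemma families_data tm :
  all (mem (map (family_data tm) (families tm))) (family_list tm).
Proof. by case: tm; vm_compute. Qed.

Lemma realizable_family tm n0 k0 n1 k1 n2 k2 a b :
  Some ((n0, k0), (n1, k1), (n2, k2)) \in family_list tm ->
  realizable tm (n0 + a * n1 + b * n2) (k0 + a * k1 + b * k2).
Proof.
move/(allP (families_data tm)) => /mapP[h _ /esym]; exact: family_realizable.
Qed.

Definition covered tm n k :=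
  exists2 h, h \in heads tm & exists a b,
    n = h.1 + a * 12 + b * short_size tm /\ k = h.2 + a * long_cost tm + b.

(** The region filled by the families with two loops. What [within] has beyond it lies on boundary
    lines: 12k = n + 12 and 7k = n + 11 for type [true], and 4k = n + 1, n + 2 or n + 3 for type
    [false]. *)
Definition core tm n k :=
  if tm then (n + 13 <= 12 * k) && (7 * k <= n + 9) else (n + 2 <= 6 * k) && (4 * k <= n).

Lemma covered_base tm n k : 34 <= n < 46 -> core tm n k -> covered tm n k.
Proof.
(* One period of the long loop, whose size is 12, is verified by computation. *)
have chk : all (fun n => all (fun k => core tm n k ==>
    has (fun h => has (fun a => has (fun b =>
      (n == h.1 + a * 12 + b * short_size tm) && (k == h.2 + a * long_cost tm + b))
      (iota 0 12)) (iota 0 4)) (heads tm)) (iota 0 12)) (iota 34 12).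
  by case: tm; vm_compute.
move=> n_bnd nk; have k_lt : k < 12.
  by move: nk; rewrite /core; case: (tm); lia.
have := allP chk n; rewrite mem_iota => /(_ n_bnd)/allP/(_ k).
rewrite mem_iota => /(_ k_lt); rewrite nk implyTb => /hasP[h hh] /hasP[a _] /hasP[b _].
by case/andP=> /eqP nE /eqP kE; exists h => //; exists a, b.
Qed.

(** Descent by removing one loop within [core]: the short one while the lower bound leaves room,
    otherwise the long one. The thresholds n + 18 and n + 4 say exactly that the lower bound
    survives the removal of the short loop. *)
Lemma core_covered tm n k : 34 <= n -> core tm n k -> covered tm n k.
Proof.
elim/ltn_ind: n k => n IH k n34 nk.
have [n46|n46] := ltnP n 46; first by apply: covered_base; rewrite ?n34.
have back a b : 34 <= n - a * 12 - b * short_size tm -> 0 < a + b ->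
    a * long_cost tm + b <= k ->
    core tm (n - a * 12 - b * short_size tm) (k - a * long_cost tm - b) ->
    covered tm n k.
  move=> n_ge ab k_ge /(IH _ _ _ n_ge)[|h hh [a' [b' [nE kE]]]].
    by move: n_ge ab; case: (tm) => /=; lia.
  exists h => //; exists (a + a'), (b + b').
  by move: n_ge k_ge nE kE; case: (tm) => /=; lia.
move: nk; rewrite /core; case tmE: tm back => /= back nk.
  have [k_big|k_small] := leqP (n + 18) (12 * k).
    by apply: (back 0 1); rewrite /core; lia.
  by apply: (back 1 0); rewrite /core; lia.
have [k_big|k_small] := leqP (n + 4) (6 * k).
  by apply: (back 0 1); rewrite /core; lia.
by apply: (back 1 0); rewrite /core; lia.
Qed.

Lemma core_realizable tm n k : 34 <= n -> core tm n k -> realizable tm n k.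
Proof.
move=> n34 /(core_covered n34)[[n0 k0] hh [a [b [/= -> ->]]]].
rewrite -[b in X in realizable _ _ X]muln1; apply: realizable_family.
by rewrite mem_cat map_f.
Qed.

Lemma within_realizable tm n k : 34 <= n -> within tm n k -> realizable tm n k.
Proof.
move=> n34 nk; have [|ncore] := boolP (core tm n k); first exact: core_realizable.
have from u n0 k0 n1 k1 n2 k2 a b : Some ((n0, k0), (n1, k1), (n2, k2)) \in family_list u ->
    n0 + a * n1 + b * n2 = n -> k0 + a * k1 + b * k2 = k -> realizable u n k.
  by move=> mem_h <- <-; exact: realizable_family.
case: tm nk ncore; rewrite /within /core /upper_shift /=.
  case/andP=> lo hi ncore; have [k_big|k_small] := leqP (n + 13) (12 * k).
    (* Beyond n + 9 there is an admissible multiple of 7 only if n is 3 modulo 7, the case where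
       [delta n] is 1. *)
    have n7 : 7 * k = n + 11.
      have := divn_eq n 7; have := ltn_pmod n (isT : 0 < 7).
      by case: (n %% 7) hi => [|[|[|[|[|[|[|r]]]]]]] /=; lia.
    by apply: (@from true 17 4 0 0 7 1 0 (k - 4)); [|lia..].
  by apply: (@from true 12 2 12 1 0 0 (k - 2) 0); [|lia..].
(* The upper end of the second interval comes from spokes alone: 9, 10 or 11 blocks of size 1 have
   value 3, and every four further ones add 1. *)
rewrite modn1 /= => nk ncore; pose x := n + 12 - 4 * k.
apply: (@from false x 3 0 0 4 1 0 (k - 3)); [|lia..].
have : x \in [:: 9; 10; 11] by rewrite !inE; lia.
by rewrite !inE => /or3P[] /eqP ->.
Qed.

(** * Blocks and states of a matching *)

Lemma valid_blocksE t w :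
  valid t P0 w -> endpoint P0 w = P0 -> exists u, w = blocks t u.
Proof.
have [m] := ubnP (size w); elim: m w => // m IH w le_w.
have cons c v : valid t P0 v -> endpoint P0 v = P0 -> size v < m ->
    exists u, block t c ++ v = blocks t u.
  by move=> vv ev lev; have [u ->] := IH v lev vv ev; exists (c :: u).
case: w le_w => [|s w] le_w; first by exists [::].
have {}cons c v : size v < m -> valid t P0 v -> endpoint P0 v = P0 ->
    exists u, block t c ++ v = blocks t u.
  by move=> ? ? ?; exact: cons.
(* Between two visits to [P0] a walk of given type has only two courses, the two blocks; a walk that
   stops inside a block does not end at [P0]. *)
case: t IH cons => _ cons.
  case: s le_w => // le_w; case: w le_w => [|[] w] //= le_w.
  case: w le_w => [|[] w] //= le_w; first by apply: (cons true w); lia.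
  by case: w le_w => [|[] w] //= le_w; apply: (cons false w); lia.
case: s le_w => /= le_w; first by apply: (cons true w).
by do 3 (case: w le_w => [|[] w] //= le_w); apply: (cons false w); lia.
Qed.

(* The state before position i, with x = a_(i-2), y = a_(i-1) and z = b_(i-1). *)
Definition decode (x y z : bool) : bool * phase :=
  (x (+) y (+) z,
   match x, z with
   | false, true => P1
   | true, true => P3
   | false, false => if y then P2 else P0
   | true, false => if y then P2 else P0
   end).

(** The degree conditions at u_i and v_i give a_i + a_(i-2) = 1 - s_i = b_i + b_(i-1), so the parity
    of the triple, which is the type, does not change. *)
Lemma decode_step (x y z a b s : bool) t p :
  decode x y z = (t, p) -> a + x + s = 1 -> b + z + s = 1 ->
  [/\ allowed t p s, (a, b, s) = step_label t p s & decode y a b = (t, phase_next p s)].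
Proof. by move=> [<- <-]; case: x y z a b s => -[] [] [] [] []. Qed.

Lemma decode_step_label (x y z a b s : bool) t p :
  decode x y z = (t, p) -> allowed t p s -> (a, b, s) = step_label t p s ->
  [/\ a + x + s = 1, b + z + s = 1 & decode y a b = (t, phase_next p s)].
Proof. by case: x y z => -[] [] [<- <-] /=; case: s => //= _ [-> ->]. Qed.

Lemma decode_walk_labels t p s s' :
  allowed t p s -> allowed t (phase_next p s) s' ->
  decode (step_label t p s).1.1 (step_label t (phase_next p s) s').1.1
    (step_label t (phase_next p s) s').1.2 =
  (t, phase_next (phase_next p s) s').
Proof. by case: t p s s' => -[] [] []. Qed.

Lemma map_walk_labels_spoke t p w : map snd (walk_labels t p w) = w.
Proof.
elim: w p => //= s w IH p; rewrite IH; congr (_ :: _).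
by case: s => //; case: p.
Qed.

(** * Edges and perfect matchings of P(n,2) *)

Definition edge_u n (i : 'I_n) := [set petersen_u i; petersen_u (ordS (ordS i))].
Definition edge_s n (i : 'I_n) := [set petersen_u i; petersen_v i].
Definition edge_v n (i : 'I_n) := [set petersen_v i; petersen_v (ordS i)].

Definition code n (X : {set {set petersen_vertex n}}) i : label :=
  (edge_u i \in X, edge_v i \in X, edge_s i \in X).

Lemma petersen2E n (e : {set petersen_vertex n}) :
  e \in petersen2 n -> exists i, [\/ e = edge_u i, e = edge_v i | e = edge_s i].
Proof.
case/setUP => [/setUP[]|] /imsetP[i _ ->]; exists i; by [constructor 1|constructor 3|constructor 2].
Qed.

Lemma mem_edges n (i : 'I_n) :
  [/\ edge_u i \in petersen2 n, edge_v i \in petersen2 n & edge_s i \in petersen2 n].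
Proof.
by split; rewrite !inE; apply/orP; [left|right|left]; rewrite ?inE;
  try (apply/orP; (left + right)); apply/imsetP; exists i.
Qed.

Lemma in_edge_u n (i : 'I_n) x :
  (x \in edge_u i) = (x == petersen_u i) || (x == petersen_u (ordS (ordS i))).
Proof. by rewrite !inE. Qed.

Lemma in_edge_s n (i : 'I_n) x :
  (x \in edge_s i) = (x == petersen_u i) || (x == petersen_v i).
Proof. by rewrite !inE. Qed.

Lemma in_edge_v n (i : 'I_n) x :
  (x \in edge_v i) = (x == petersen_v i) || (x == petersen_v (ordS i)).
Proof. by rewrite !inE. Qed.

Lemma val_iter_ordS n k (i : 'I_n) : iter k (@ordS n) i = (i + k) %% n :> nat.
Proof.
elim: k => [|k IH]; first by rewrite addn0 modn_small.
by rewrite iterS /= IH -addn1 modnDml addn1 addnS.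
Qed.

Lemma iter_ordS_eq n k m (i : 'I_n) :
  (iter k (@ordS n) i == iter m (@ordS n) i) = (k == m %[mod n]).
Proof. by rewrite -val_eqE /= !val_iter_ordS eqn_modDl. Qed.

Lemma iter_ordS_neq n k (i : 'I_n) : 0 < k < n -> (iter k (@ordS n) i == i) = false.
Proof.
case/andP=> k0 kn; rewrite -[X in _ == X]/(iter 0 (@ordS n) i) iter_ordS_eq mod0n modn_small //.
by rewrite eqn0Ngt k0.
Qed.

(** Different indices could share an edge only as u_i u_(i+2) = u_(i+2) u_(i+4) with i + 4 = i
    modulo n, which n >= 5 excludes. *)
Lemma eq_edge_u n (i j : 'I_n) : 5 <= n -> (edge_u i == edge_u j) = (i == j).
Proof.
move=> n5; apply/eqP/eqP => [e|-> //].
have : petersen_u i \in edge_u j by rewrite -e in_edge_u eqxx.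
have : petersen_u j \in edge_u i by rewrite e in_edge_u eqxx.
rewrite !in_edge_u !(inj_eq (@inl_inj _ _)) => /orP[/eqP //|/eqP jE] /orP[/eqP //|].
by rewrite jE eq_sym (@iter_ordS_neq n 4) //; lia.
Qed.

Lemma eq_edge_v n (i j : 'I_n) : 5 <= n -> (edge_v i == edge_v j) = (i == j).
Proof.
move=> n5; apply/eqP/eqP => [e|-> //].
have : petersen_v i \in edge_v j by rewrite -e in_edge_v eqxx.
have : petersen_v j \in edge_v i by rewrite e in_edge_v eqxx.
rewrite !in_edge_v !(inj_eq (@inr_inj _ _)) => /orP[/eqP //|/eqP jE] /orP[/eqP //|].
by rewrite jE eq_sym (@iter_ordS_neq n 2) //; lia.
Qed.

Lemma eq_edge_s n (i j : 'I_n) : (edge_s i == edge_s j) = (i == j).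
Proof.
apply/eqP/eqP => [e|-> //].
have : petersen_u i \in edge_s j by rewrite -e in_edge_s eqxx.
by rewrite in_edge_s (inj_eq (@inl_inj _ _)) orbF => /eqP.
Qed.

Lemma vertex_eqE n (i j : 'I_n) :
  ((petersen_u i == petersen_u j) = (i == j)) * ((petersen_v i == petersen_v j) = (i == j)) *
  ((petersen_u i == petersen_v j) = false) * ((petersen_v i == petersen_u j) = false).
Proof. by []. Qed.

Lemma neq_edges n (i j : 'I_n) :
  ((edge_u i == edge_v j) = false) * ((edge_v i == edge_u j) = false) *
  ((edge_u i == edge_s j) = false) * ((edge_s i == edge_u j) = false) *
  ((edge_v i == edge_s j) = false) * ((edge_s i == edge_v j) = false).
Proof.
have uv (k l : 'I_n) : (edge_u k == edge_v l) = false.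
  by apply/eqP => e; have := in_edge_u k (petersen_u k); rewrite e in_edge_v eqxx.
have us (k l : 'I_n) : (edge_u k == edge_s l) = false.
  by apply/eqP => e; have := in_edge_u k (petersen_v l); rewrite e in_edge_s eqxx.
have vs (k l : 'I_n) : (edge_v k == edge_s l) = false.
  by apply/eqP => e; have := in_edge_v k (petersen_u l); rewrite e in_edge_s eqxx.
by rewrite !(eq_sym (edge_s i)) (eq_sym (edge_v i) (edge_u j)) !uv !us !vs.
Qed.

Lemma card_setI_seq (T : finType) (X : {set T}) (s : seq T) :
  uniq s -> #|[set e in X | e \in s]| = count (mem X) s.
Proof.
move=> us; rewrite -size_filter -(card_uniqP (filter_uniq _ us)).
by apply: eq_card => e; rewrite inE mem_filter.
Qed.

Lemma card_edges n (X : {set {set petersen_vertex n}}) :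
  5 <= n -> X \subset petersen2 n -> #|X| = \sum_(i < n) label_weight (code X i).
Proof.
move=> n5 XE; pose s := map (@edge_u n) (enum 'I_n) ++ map (@edge_v n) (enum 'I_n) ++
  map (@edge_s n) (enum 'I_n).
have us : uniq s.
  have inj_uniq (f : 'I_n -> {set petersen_vertex n}) :
      (forall i j, (f i == f j) = (i == j)) -> uniq (map f (enum 'I_n)).
    by move=> fE; rewrite map_inj_uniq ?enum_uniq // => i j /eqP; rewrite fE => /eqP.
  rewrite !cat_uniq; apply/and5P; split.
  - by apply: inj_uniq => i j; rewrite eq_edge_u.
  - apply/hasPn => e; rewrite mem_cat => /orP[] /mapP[i _ ->]; apply/negP => /mapP[j _] /eqP;
    by rewrite neq_edges.
  - by apply: inj_uniq => i j; rewrite eq_edge_v.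
  - apply/hasPn => e /mapP[i _ ->]; apply/negP => /mapP[j _] /eqP.
    by rewrite neq_edges.
  - by apply: inj_uniq => i j; rewrite eq_edge_s.
transitivity (count (mem X) s).
  rewrite -card_setI_seq //; apply: eq_card => e; rewrite inE.
  case eX: (e \in X) => //=; have [i] := petersen2E (subsetP XE e eX).
  by rewrite !mem_cat => -[] ->; rewrite map_f ?mem_enum ?orbT.
have cnt (f : 'I_n -> {set petersen_vertex n}) :
    count (mem X) (map f (enum 'I_n)) = \sum_(i < n) (f i \in X).
  by rewrite count_map -sum1_count big_mkcond /= big_enum; apply: eq_bigr => i _; case: ifP.
rewrite !count_cat !cnt -!big_split /=; apply: eq_bigr => i _.
by rewrite /label_weight /= addnA.
Qed.

(** The two sums are the degrees of u_(j+2) and v_(j+2) in X. The shift by 2 makes them govern the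
    step out of the state given by positions j and j + 1. *)
Definition balanced n (X : {set {set petersen_vertex n}}) (j : 'I_n) :=
  let '(a, b, _) := code X j in let '(_, b', _) := code X (ordS j) in
  let '(a2, b2, s2) := code X (ordS (ordS j)) in
  (a2 + a + s2 == 1) && (b2 + b' + s2 == 1).

Lemma ordS_inj n : injective (@ordS n).
Proof. exact: can_inj (@ordSK n). Qed.

Lemma perfect_matchingE n (X : {set {set petersen_vertex n}}) : 5 <= n ->
  perfect_matching (petersen2 n) X =
  (X \subset petersen2 n) && [forall j, balanced X j].
Proof.
move=> n5; rewrite /perfect_matching; case: (boolP (X \subset _)) => //= XE.
have i1 (j : 'I_n) : (ordS j == j) = false by apply: (@iter_ordS_neq n 1); lia.
have i2 (j : 'I_n) : (ordS (ordS j) == j) = false by apply: (@iter_ordS_neq n 2); lia.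
have degree x (e1 e2 e3 : {set petersen_vertex n}) : uniq [:: e1; e2; e3] ->
    (forall e, e \in X -> (x \in e) = (e \in [:: e1; e2; e3])) ->
    #|[set e in X | x \in e]| = (e1 \in X) + (e2 \in X) + (e3 \in X).
  move=> us xE; transitivity (count (mem X) [:: e1; e2; e3]); last by rewrite /= addn0 addnA.
  rewrite -card_setI_seq //; apply: eq_card => e; rewrite !inE.
  by case eX: (e \in X) => //=; rewrite xE // !inE.
have degree_u j : #|[set e in X | petersen_u (ordS (ordS j)) \in e]| =
    (edge_u (ordS (ordS j)) \in X) + (edge_u j \in X) + (edge_s (ordS (ordS j)) \in X).
  apply: degree => [|e /(subsetP XE)/petersen2E[i]].
    by rewrite /= !inE !neq_edges eq_edge_u // i2.
  by case=> ->; rewrite ?in_edge_u ?in_edge_v ?in_edge_s !inE !vertex_eqE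
    !neq_edges ?eq_edge_u ?eq_edge_s // ?(inj_eq (@ordS_inj _)) ?orbF ?orFb ?(eq_sym i) //= ?(eq_sym i).
have degree_v j : #|[set e in X | petersen_v (ordS j) \in e]| =
    (edge_v (ordS j) \in X) + (edge_v j \in X) + (edge_s (ordS j) \in X).
  apply: degree => [|e /(subsetP XE)/petersen2E[i]].
    by rewrite /= !inE !neq_edges eq_edge_v // i1.
  by case=> ->; rewrite ?in_edge_u ?in_edge_v ?in_edge_s !inE !vertex_eqE
    !neq_edges ?eq_edge_v ?eq_edge_s // ?(inj_eq (@ordS_inj _)) ?orbF ?orFb ?(eq_sym i) //= ?(eq_sym i).
apply/forallP/forallP => [deg j|bal x].
  by rewrite /balanced /= -degree_u -degree_v !deg.
case: x => i; rewrite -[i]ord_predK.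
  have := bal (ord_pred (ord_pred i)); rewrite /balanced /= -degree_u.
  by rewrite !ord_predK => /andP[].
by have := bal (ord_pred (ord_pred i)); rewrite /balanced /= -degree_v !ord_predK => /andP[].
Qed.

(** * Reading a matching around the cycle as a closed walk *)

Definition around n (i : 'I_n) := traject (@ordS n) i n.

(* The state before position [i + 2] is determined by the labels of [i] and [i + 1]. *)
Definition around2 n (i : 'I_n) := around (ordS (ordS i)).

Definition state_at n (X : {set {set petersen_vertex n}}) (i : 'I_n) :=
  decode (code X i).1.1 (code X (ordS i)).1.1 (code X (ordS i)).1.2.

Definition labels n (X : {set {set petersen_vertex n}}) i := map (code X) (around2 i).

Definition spokes n (X : {set {set petersen_vertex n}}) i := map snd (labels X i).

Lemma mem_around n (i j : 'I_n) : j \in around i.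
Proof.
(* The witness is the number of successor steps from [i] to [j]. *)
apply/trajectP; exists ((j + (n - i)) %% n).
  by rewrite ltn_mod; case: (n) i => [[]|].
apply: val_inj; rewrite /= val_iter_ordS modnDmr addnCA subnKC; last exact: ltnW.
by rewrite modnDr modn_small.
Qed.

Lemma uniq_around n (i : 'I_n) : uniq (around i).
Proof.
apply/(uniqP i) => k m; rewrite !inE size_traject => kn mn.
by rewrite !nth_traject // => /eqP; rewrite iter_ordS_eq !modn_small // => /eqP.
Qed.

Lemma perm_around n (i : 'I_n) : perm_eq (around i) (enum 'I_n).
Proof.
by apply: uniq_perm; rewrite ?uniq_around ?enum_uniq // => j; rewrite mem_around mem_enum.
Qed.

Lemma iter_ordS_n n (i : 'I_n) : iter n (@ordS n) i = i.
Proof. by apply: val_inj; rewrite /= val_iter_ordS modnDr modn_small. Qed.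

Lemma size_labels n (X : {set {set petersen_vertex n}}) i : size (labels X i) = n.
Proof. by rewrite size_map size_traject. Qed.

Lemma weight_labels n (X : {set {set petersen_vertex n}}) i : 5 <= n ->
  X \subset petersen2 n -> weight (labels X i) = #|X|.
Proof.
move=> n5 XE; rewrite card_edges // /weight sumnE !big_map.
by rewrite (perm_big _ (perm_around _)) /= big_enum.
Qed.

Lemma labels_inj n (X Y : {set {set petersen_vertex n}}) i :
  X \subset petersen2 n -> Y \subset petersen2 n -> labels X i = labels Y i -> X = Y.
Proof.
move=> XE YE /eq_in_map XY.
have cXY j : code X j = code Y j by apply: XY; rewrite mem_around.
apply/setP => e; case: (boolP (e \in petersen2 n)) => [/petersen2E[j]|eE].
  by have [] := cXY j; move=> ? ? ?; case=> ->.
by rewrite (negbTE (contra (subsetP XE e) eE)) (negbTE (contra (subsetP YE e) eE)).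
Qed.

Lemma sub_labels n (X Y : {set {set petersen_vertex n}}) i :
  X \subset petersen2 n -> (X \subset Y) = all2 sublabel (labels X i) (labels Y i).
Proof.
move=> XE; have -> : all2 sublabel (labels X i) (labels Y i) =
    all (fun j => sublabel (code X j) (code Y j)) (around2 i).
  by rewrite /labels; elim: (around2 i) => //= j s ->.
apply/subsetP/allP => [XY j _|XY e eX].
  by apply/and3P; split; apply/implyP; exact: XY.
have [j] := petersen2E (subsetP XE e eX); have := XY j (mem_around _ _).
by case/and3P=> /implyP ? /implyP ? /implyP ?; case=> eE; move: eX; rewrite eE.
Qed.

Lemma labels_surj n (i : 'I_n) (F : seq label) : 5 <= n -> size F = n ->
  exists2 X : {set {set petersen_vertex n}}, X \subset petersen2 n & labels X i = F.
Proof.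
move=> n5 sF; pose g j := nth (false, false, false) F (index j (around2 i)).
pose P e := [exists j, [|| (e == edge_u j) && (g j).1.1, (e == edge_v j) && (g j).1.2
  | (e == edge_s j) && (g j).2]].
pose X := [set e in petersen2 n | P e].
have memX e : e \in petersen2 n -> (e \in X) = P e by move=> eE; rewrite inE eE.
exists X; first by apply/subsetP => e; rewrite inE => /andP[].
have cX j : code X j = g j.
  have [uE vE sE] := mem_edges j; rewrite /code !memX // [RHS]surjective_pairing.
  rewrite [(g j).1]surjective_pairing; congr (_, _, _); apply/existsP/idP => [[k]|gj].
  - by rewrite !neq_edges eq_edge_u // !orbF => /andP[/eqP->].
  - by exists j; rewrite eqxx gj.
  - by rewrite !neq_edges eq_edge_v // !orbF => /andP[/eqP->].
  - by exists j; rewrite eqxx gj orbT.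
  - by rewrite !neq_edges eq_edge_s // => /andP[/eqP->].
  - by exists j; rewrite eqxx gj !orbT.
apply: (@eq_from_nth _ (false, false, false)); first by rewrite size_labels sF.
move=> k; rewrite size_labels => kn.
rewrite (nth_map i) ?size_traject // cX /g index_uniq ?size_traject //.
exact: uniq_around.
Qed.

Lemma state_at_step n (X : {set {set petersen_vertex n}}) j t p :
    balanced X j -> state_at X j = (t, p) ->
  let l := code X (ordS (ordS j)) in
  [/\ allowed t p l.2, l = step_label t p l.2 & state_at X (ordS j) = (t, phase_next p l.2)].
Proof.
move=> /andP[/eqP au /eqP bv] jE.
exact: (@decode_step _ _ _ _ _ _ _ _ jE au bv).
Qed.

Lemma traject_walk n (X : {set {set petersen_vertex n}}) (i : 'I_n) m t p :
  (forall j, balanced X j) -> state_at X i = (t, p) ->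
  let w := map snd (map (code X) (traject (@ordS n) (ordS (ordS i)) m)) in
  [/\ valid t p w, walk_labels t p w = map (code X) (traject (@ordS n) (ordS (ordS i)) m)
    & state_at X (iter m (@ordS n) i) = (t, endpoint p w)].
Proof.
move=> bal; elim: m i p => // m IH i p iE.
have [okp lE iE'] := state_at_step (bal i) iE.
have [vw lw ew] := IH _ _ iE'; split; rewrite -?iterSr ?iterSr //=.
  by rewrite okp.
by rewrite lw -lE.
Qed.

Lemma walk_traject n (X : {set {set petersen_vertex n}}) (i : 'I_n) t p w :
  state_at X i = (t, p) -> valid t p w ->
  map (code X) (traject (@ordS n) (ordS (ordS i)) (size w)) = walk_labels t p w ->
  {in traject (@ordS n) i (size w), forall j, balanced X j}.
Proof.
elim: w i p => // s w IH i p iE /= /andP[okp vw] [lE lw].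
have sE : (code X (ordS (ordS i))).2 = s by rewrite lE; case: (s) => //; case: (p).
have := @decode_step_label _ _ _ (code X (ordS (ordS i))).1.1
  (code X (ordS (ordS i))).1.2 s t p iE okp.
case; first by rewrite -lE -sE -!surjective_pairing.
move=> au bv iE'; move=> j; rewrite inE => /orP[/eqP->|jw]; last exact: (IH _ _ iE' vw lw).
by rewrite /balanced; move: au bv; rewrite -sE /= => -> ->.
Qed.

Lemma perfect_matching_walk n (X : {set {set petersen_vertex n}}) i t p : 5 <= n ->
  perfect_matching (petersen2 n) X -> state_at X i = (t, p) ->
  [/\ valid t p (spokes X i), walk_labels t p (spokes X i) = labels X i
    & endpoint p (spokes X i) = p].
Proof.
move=> n5; rewrite perfect_matchingE // => /andP[_ /forallP bal] iE.
have [vw lw] := traject_walk n bal iE; rewrite iter_ordS_n iE => -[ew].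
by split.
Qed.

Lemma walk_perfect_matching n (i : 'I_n) t p w : 5 <= n ->
  size w = n -> valid t p w -> endpoint p w = p ->
  exists X : {set {set petersen_vertex n}},
    [/\ perfect_matching (petersen2 n) X, labels X i = walk_labels t p w,
    state_at X i = (t, p) & spokes X i = w].
Proof.
move=> n5 sw vw ew; have [|X XE lX] := @labels_surj n i (walk_labels t p w) n5.
  by rewrite size_walk_labels.
(* The reading starts at i + 2 and ends with i and i + 1, so the last two labels determine the state
   at [i]; it is (t, p) because the walk is closed. *)
have iE : state_at X i = (t, p).
  case/lastP: w sw vw ew lX => [|w s2]; first by move=> /= sw; lia.
  case/lastP: w => [|w s1]; first by move=> /= sw; lia.
  rewrite !size_rcons => sw vw ew lX; move: vw ew lX.
  have iE : iter (size w) (@ordS n) (ordS (ordS i)) = i.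
    by rewrite -!iterSr sw iter_ordS_n.
  have aE : around2 i = rcons (rcons (traject (@ordS n) (ordS (ordS i)) (size w)) i) (ordS i).
    by rewrite /around2 /around -[X in traject _ _ X]sw !trajectSr iterS iE.
  rewrite !endpoint_rcons /labels aE !map_rcons -!cats1 -!catA.
  rewrite valid_cat walk_labels_cat /= !andbT => /and3P[vw ok1 ok2] ew.
  move/eqP; rewrite eqseq_cat; last by rewrite size_map size_traject size_walk_labels.
  by case/andP=> _ /eqP[l1 l2]; rewrite -[p in RHS]ew -(decode_walk_labels ok1 ok2) -l1 -l2.
exists X; split=> //; last by rewrite /spokes lX map_walk_labels_spoke.
rewrite perfect_matchingE // XE; apply/forallP => j.
by apply: (walk_traject iE vw); rewrite sw ?mem_around.
Qed.

(** Read from the same position [i], every perfect matching is a closed walk, but its state there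
    may be any type and phase. This is why [forcing] quantifies over all of them. *)
Lemma forcing_setP n (M S : {set {set petersen_vertex n}}) i tm : 5 <= n ->
  perfect_matching (petersen2 n) M -> S \subset petersen2 n -> state_at M i = (tm, P0) ->
  forcing_set (petersen2 n) M S <-> forcing tm (spokes M i) (labels S i).
Proof.
move=> n5 pM SE iE; have [vM lM eM] := perfect_matching_walk n5 pM iE.
have subE X : perfect_matching (petersen2 n) X -> forall t p, state_at X i = (t, p) ->
    (S \subset X) = compat t p (spokes X i) (labels S i).
  move=> pX t p XE; have [vX lX _] := perfect_matching_walk n5 pX XE.
  by rewrite /compat vX lX; apply: sub_labels.
split=> [/andP[SM /forallP fM]|[cM fM]]; last first.
  apply/andP; split; first by rewrite (subE M pM _ _ iE).
  apply/forallP => X; apply/implyP => /andP[pX SX]; apply/eqP.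
  case XE : (state_at X i) => [t p].
  have [vX lX eX] := perfect_matching_walk n5 pX XE.
  have := fM t p (spokes X i); rewrite -(subE X pX) // => /(_ SX eX)[tE pE wE].
  apply: (@labels_inj _ X M i); try by move: pX pM => /andP[? _] /andP[].
  by rewrite -lX -lM wE tE pE.
split=> [|t p w cw ew]; first by rewrite -(subE M pM _ _ iE).
have [vw _] := andP cw.
have sw : size w = n by rewrite (compat_size cw) size_labels.
have [X [pX lX XE wE]] := walk_perfect_matching i n5 sw vw ew.
have SX : S \subset X by rewrite (subE X pX t p) // wE.
have := fM X; rewrite pX SX => /eqP XM; move: XE wE; rewrite XM iE => -[-> ->] ->.
by [].
Qed.

(** [labels] translates edge sets into label sequences and preserves the number of edges, so the two
    minima agree. *)
Lemma forcing_number_value n (M : {set {set petersen_vertex n}}) i tm u : 5 <= n ->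
  perfect_matching (petersen2 n) M -> state_at M i = (tm, P0) ->
  spokes M i = blocks tm u -> forcing_number (petersen2 n) M = value (run tm u).
Proof.
move=> n5 pM iE wE.
have E0 e : e \in petersen2 n -> e != set0.
  move=> eE; rewrite -card_gt0 (petersen2_simple _ eE) //; lia.
have [[S0 fS0 <-] minS] := forcing_numberP E0 pM.
have sE S : forcing_set (petersen2 n) M S -> S \subset petersen2 n.
  by case/andP=> SM _; case/andP: pM => ME _; exact: subset_trans ME.
have fE (S : {set {set petersen_vertex n}}) : S \subset petersen2 n ->
    forcing_set (petersen2 n) M S <-> forcing tm (blocks tm u) (labels S i).
  by move=> SE; rewrite -wE; exact: forcing_setP.
have [|[F fF <-] minF] := @value_correct tm u.
  by exists (labels S0 i); apply/fE => //; exact: sE.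
apply/eqP; rewrite eqn_leq; apply/andP; split; last first.
  by rewrite -(weight_labels i n5 (sE _ fS0)) minF //; apply/fE => //; exact: sE.
have [|S SE lS] := @labels_surj n i F n5.
  by rewrite -(compat_size fF.1) -wE /spokes size_map size_labels.
by rewrite -lS (weight_labels i n5 SE) minS //; apply/fE; rewrite ?lS.
Qed.

(** Each step resets the phase to [P0] or advances it, so [P0] occurs within three steps. This lets
    the reading start at the beginning of a block. *)
Lemma exists_P0 n (X : {set {set petersen_vertex n}}) : 5 <= n ->
  perfect_matching (petersen2 n) X -> exists i t, state_at X i = (t, P0).
Proof.
move=> n5; rewrite perfect_matchingE // => /andP[_ /forallP bal].
have i0 : 'I_n by exists 0; lia.
have next_state j t p : state_at X j = (t, p) ->
    state_at X (ordS j) = (t, P0) \/ state_at X (ordS j) = (t, phase_succ p).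
  move=> jE; have [_ _] := state_at_step (bal j) jE.
  by case: (code _ _).2; [left | right].
have from3 j t : state_at X j = (t, P3) -> exists i t, state_at X i = (t, P0).
  by move=> /next_state[] ?; exists (ordS j), t.
have from2 j t : state_at X j = (t, P2) -> exists i t, state_at X i = (t, P0).
  by move=> /next_state[?|]; [exists (ordS j), t | exact: from3].
case iE : (state_at X i0) => [t []].
- by exists i0, t.
- by case/next_state: iE => [?|/from2 //]; exists (ordS i0), t.
- exact: from2 iE.
- exact: from3 iE.
Qed.

Lemma forcing_spectrumE n k : 5 <= n ->
  (k \in forcing_spectrum (petersen2 n)) <-> exists tm, realizable tm n k.
Proof.
move=> n5; split=> [/existsP[M /andP[pM /eqP <-]]|[tm [u [sz <-]]]].
  have [i [tm iE]] := exists_P0 n5 pM.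
  have [vw _ ew] := perfect_matching_walk n5 pM iE.
  have [u uE] := valid_blocksE vw ew.
  exists tm, u; rewrite (forcing_number_value n5 pM iE uE).
  by rewrite -uE /spokes size_map size_labels.
have i0 : 'I_n by exists 0; lia.
have [M [pM _ iE wE]] := walk_perfect_matching i0 n5 sz (valid_blocks tm u) (endpoint_blocks tm u).
by apply/existsP; exists M; rewrite pM (forcing_number_value n5 pM iE wE) eqxx.
Qed.

(** * The two intervals *)

Lemma within_true n k : within true n k = (ceil_div n 12 + 1 <= k <= ceil_div (n + 3) 7 + delta n).
Proof.
rewrite /within /ceil_div /delta /upper_shift /=.
(* Each residue modulo 7 turns the upper end into one entry of [upper_shift]. *)
have := divn_eq n 7; have := ltn_pmod n (isT : 0 < 7).
case: (n %% 7) => [|[|[|[|[|[|[|r]]]]]]] //=; lia.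
Qed.

Lemma within_false n k : within false n k = (ceil_div (n + 2) 6 <= k <= ceil_div n 4).
Proof. by rewrite /within /ceil_div /upper_shift modn1 /=; lia. Qed.

Theorem mainTheorem1 (n : nat) (hn : 34 <= n) :
  forcing_spectrum (petersen2 n) =i
  [pred t : nat |
     (ceil_div n 12 + 1 <= t <= ceil_div (n + 3) 7 + delta n)
     || (ceil_div (n + 2) 6 <= t <= ceil_div n 4)].
Proof.
move=> t; rewrite [RHS]inE /= -within_true -within_false; apply/idP/idP => [|t_in].
  case/forcing_spectrumE=> [|tm [u [sz <-]]]; first by lia.
  have : within tm n (value (run tm u)) by rewrite -sz value_within // sz (leq_trans _ hn).
  by case: tm {sz} => ->; rewrite ?orbT.
apply/forcing_spectrumE; first by lia.
by case/orP: t_in => /within_realizable r; [exists true | exists false]; apply: r.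
Qed.
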